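(* For any $1\le k'\le k$, with $m=\Theta(\frac{k}{k'})$ machines, the output of any algorithm is at most an $O(\sqrt{\frac{k'}{k}})$-approximate randomized composable core-set of size $k'$ (multiplicity $1$) for the monotone submodular maximization problem with cardinality constraint $k$; i.e., there are instances (coverage functions) on which every algorithm $\mathsf{ALG}$ with output size at most $k'$ satisfies $\mathbb E[f_k(\bigcup_{i=1}^m\mathsf{ALG}(T_i))]=O(\sqrt{k'/k})\cdot\max_{|S|\le k}f(S)$.
   Context: For a finite ground set $\mathbb N$ and $f:2^{\mathbb N}\to\mathbb R_{\ge0}$, $f_k(S)=\max_{S'\subseteq S,|S'|\le k}f(S')$. Each item is sent to one of the $m$ machines chosen independently and uniformly at random; $T_i$ is the set of items sent to machine $i$. A coverage function: items are subsets of a universe and $f(S)$ is the cardinality of the union of the sets represented by items of $S$. *)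

(* Defs.v *)
From HB Require Import structures.
From mathcomp Require Import all_boot all_order all_algebra.
From mathcomp Require Import reals.

Set Implicit Arguments.
Unset Strict Implicit.
Unset Printing Implicit Defensive.

Import Order.TTheory GRing.Theory Num.Theory.
Local Open Scope ring_scope.

Section SetFunctions.
Context {R : realType} {N : finType}.
Implicit Types (f : {set N} -> R) (S T : {set N}).

Definition nonneg_fun f := forall S, 0 <= f S.

Definition monotone_fun f := forall S T, S \subset T -> f S <= f T.

Definition submodular f :=
  forall S T, f (S :|: T) + f (S :&: T) <= f S + f T.

(* [set0] is always feasible, so starting the maximum at [f set0] makes this
   exactly the maximum over S' \subset S with #|S'| <= k. *)
Definition best (k : nat) f S : R :=
  \big[Num.max/f set0]_(S' : {set N} | (S' \subset S) && (#|S'| <= k)%N) f S'.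

(* The value oracle available to a machine holding T: it carries no
   information on f beyond its values on subsets of T. *)
Definition local_oracle f T : {set N} -> R := fun S => f (S :&: T).

End SetFunctions.

Definition coverage (R : realType) (N U : finType) (c : N -> {set U})
  (S : {set N}) : R := #|\bigcup_(x in S) c x|%:R.

(* A possibly randomized algorithm with output size at most k': [law g T A] is
   the probability that it returns A on the item set T with value oracle g.
   Deterministic algorithms are those whose laws are Dirac masses.  It runs on
   all finite ground sets and is not told the function behind the oracle; see
   [expected_value] for the oracle it is run with. *)
Record algorithm (R : realType) (k' : nat) := Algorithm {
  law : forall N : finType, ({set N} -> R) -> {set N} -> {set N} -> R;
  law_ge0 : forall (N : finType) (g : {set N} -> R) (T A : {set N}),
    0 <= law g T A;
  law_sum1 : forall (N : finType) (g : {set N} -> R) (T : {set N}),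
    \sum_(A : {set N}) law g T A = 1;
  law_output : forall (N : finType) (g : {set N} -> R) (T A : {set N}),
    law g T A != 0 -> A \subset T /\ (#|A| <= k')%N
}.

Section RandomPartition.
Context {R : realType} {k' : nat}.
Variables (ALG : algorithm R k') (m k : nat).

Definition part (N : finType) (a : {ffun N -> 'I_m}) (i : 'I_m) : {set N} :=
  [set x | a x == i].

(* E[f_k(ALG(T_1) :|: ... :|: ALG(T_m))].  Sending each item independently to a
   uniform machine is drawing a uniform a : {ffun N -> 'I_m}; the machines use
   independent coins, O i being the output of machine i. *)
Definition expected_value (N : finType) (f : {set N} -> R) : R :=
  (\sum_(a : {ffun N -> 'I_m})
     \sum_(O : {ffun 'I_m -> {set N}})
       (\prod_(i < m) law ALG (local_oracle f (part a i)) (part a i) (O i))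
         * best k f (\bigcup_(i < m) O i))
  / #|{ffun N -> 'I_m}|%:R.

(* Multiplicity 1: every item is sent to exactly one machine. *)
Definition randomized_coreset (alpha : R) :=
  forall (N : finType) (f : {set N} -> R),
    nonneg_fun f -> monotone_fun f -> submodular f ->
    alpha * best k f setT <= expected_value f.

End RandomPartition.

(* Main.v *)
(** Hide [k] optimal items, each alone in its class, among [r] decoy classes of
about [m / 2] items each, where [r] is about [sqrt (k k')]; every class is worth
[k].  On the machine of a given optimal item, a decoy that is the only one of
its class there looks exactly like the optimal item, so, averaging over the
names of the items, the [D] isolated decoys and the optimal item are equally
likely to be output: the latter is output with probability at most
[k' / (1 + D)].  Each decoy class is isolated with probability at least [1 / 4],
which makes the mean of [1 / (1 + D)] at most [4 / r]: if [X_j] tells whether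
class [j] is isolated and [D_j] is the sum of the others, then [X_j] and [D_j]
are independent, so [E (1 / (1 + D)) <= 4 E (X_j / (1 + D_j)) = 4 E (X_j / D)],
and the sum over [j] of [X_j / D] is at most [1].  Hence only
[O (k k' / r) = O (sqrt (k k'))] optimal items are output on average, while the
decoys bring at most [r] more classes. *)

Require Import Defs.
From HB Require Import structures.
From mathcomp Require Import all_boot all_order all_algebra all_fingroup.
From mathcomp Require Import reals boolp zify ring lra.

Set Implicit Arguments.
Unset Strict Implicit.
Unset Printing Implicit Defensive.

Import Order.TTheory GRing.Theory Num.Theory.
Local Open Scope ring_scope.

(** * Coverage functions are monotone and submodular *)

Section Coverage.
Variables (R : realType) (N U : finType) (c : N -> {set U}).

Lemma coverage_nonneg : nonneg_fun (@coverage R N U c).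
Proof. by move=> S; exact: ler0n. Qed.

Lemma coverage_monotone : monotone_fun (@coverage R N U c).
Proof.
move=> S T sST; rewrite ler_nat subset_leq_card //.
apply/bigcupsP => x xS; exact: (bigcup_sup x (subsetP sST x xS)).
Qed.

Lemma coverage_submodular : submodular (@coverage R N U c).
Proof.
move=> S T; rewrite -!natrD ler_nat.
rewrite bigcup_setU -[leqRHS]cardsUI leq_add2l subset_leq_card //.
apply/bigcupsP => x; rewrite inE => /andP[xS xT].
by rewrite subsetI (bigcup_sup x xS) // (bigcup_sup x xT).
Qed.

End Coverage.

(** * Class-counting coverage functions, and what an oracle cannot tell apart *)

Section Blocks.
Variables (R : realType) (N Q : finType) (w : nat).

(* The points [inr y] only serve to make [block_cover q] injective; [w] makes
   their contribution negligible. *)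
Definition block_cover (q : N -> Q) (x : N) : {set Q * 'I_w + N} :=
  [set u | match u with inl e => e.1 == q x | inr y => y == x end].

Definition block_value (q : N -> Q) : {set N} -> R :=
  coverage R (block_cover q).

Lemma block_cover_inj q : injective (block_cover q).
Proof.
move=> x y /setP/(_ (inr x)); rewrite !inE eqxx => /esym/eqP; exact.
Qed.

Lemma block_valueE q S : block_value q S = (w * #|q @: S| + #|S|)%:R.
Proof.
rewrite /block_value /coverage; congr (_%:R).
have -> : \bigcup_(x in S) block_cover q x =
    [set inl e | e in setX (q @: S) [set: 'I_w]] :|: [set inr y | y in S].
  apply/setP => u; rewrite inE; apply/bigcupP/orP.
    case=> x xS; rewrite inE; case: u => [[e i]|y] /= /eqP->.
      by left; apply: imset_f; rewrite in_setX inE imset_f.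
    by right; apply: imset_f.
  case=> /imsetP[].
    move=> [e i]; rewrite in_setX => /andP[/imsetP[x xS /= ->] _] ->.
    by exists x; rewrite ?inE /=.
  by move=> y yS ->; exists y; rewrite ?inE /=.
rewrite cardsU (_ : _ :&: _ = set0) ?cards0 ?subn0; last first.
  apply/setP => u; rewrite !inE; apply/negP => /andP[/imsetP[e _ ->]].
  by case/imsetP.
rewrite (card_imset _ (@inl_inj _ _)) (card_imset _ (@inr_inj _ _)).
by rewrite cardsX cardsT card_ord mulnC.
Qed.

Definition alone (q : N -> Q) (T : {set N}) (x : N) :=
  x \in T /\ {in T, forall y, q y = q x -> y = x}.

(** Indistinguishability: on subsets of [T], exchanging two items that are alone in their classes
    amounts to transposing the names of these classes, and the value only counts the classes met. *)
Lemma local_oracle_swap q (T : {set N}) x y :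
  alone q T x -> alone q T y ->
  local_oracle (block_value (q \o tperm x y)) T =
  local_oracle (block_value q) T.
Proof.
move=> [xT ax] [yT ay]; apply/funext => S; rewrite /local_oracle !block_valueE.
congr (_ * _ + _)%:R.
have -> : (q \o tperm x y) @: (S :&: T) =
          tperm (q x) (q y) @: (q @: (S :&: T)).
  rewrite -imset_comp; apply: eq_in_imset => z; rewrite inE => /andP[_ zT] /=.
  case: tpermP => [->|->|/eqP zx /eqP zy]; rewrite ?tpermL ?tpermR //.
  rewrite tpermD //.
    by apply: contra_neq zx => /esym; exact: ax.
  by apply: contra_neq zy => /esym; exact: ay.
by rewrite card_imset //; exact: perm_inj.
Qed.

End Blocks.

(** * Bounding the expected value by the output probabilities of a few items *)

Section ExpectedValue.
Variables (R : realType) (k' : nat) (ALG : algorithm R k').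

Definition output_prob (N : finType) (f : {set N} -> R) (T : {set N})
    (x : N) : R :=
  \sum_(A : {set N}) law ALG (local_oracle f T) T A * (x \in A)%:R.

Lemma sum_output_prob (N : finType) (f : {set N} -> R) (T X : {set N}) :
  \sum_(x in X) output_prob f T x <= k'%:R.
Proof.
have -> : k'%:R = \sum_A law ALG (local_oracle f T) T A * k'%:R :> R.
  by rewrite -mulr_suml law_sum1 mul1r.
rewrite exchange_big /=; apply: ler_sum => A _; rewrite -mulr_sumr.
have [-> | nz] := eqVneq (law ALG (local_oracle f T) T A) 0.
  by rewrite !mul0r.
apply: ler_wpM2l; first exact: law_ge0.
rewrite -natr_sum ler_nat.
apply: leq_trans (law_output nz).2.
rewrite -sum1_card [leqRHS]big_mkcond [leqLHS]big_mkcond /=.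
by apply: leq_sum => x _; case: (x \in X); case: (x \in A).
Qed.

(** Marginal law of one machine: the coins are independent, and the laws of the other machines sum
    to 1. *)
Lemma sum_output_law (m : nat) (N : finType) (g : 'I_m -> {set N} -> R)
    (T : 'I_m -> {set N}) (i : 'I_m) (h : {set N} -> R) :
  \sum_(O : {ffun 'I_m -> {set N}})
    (\prod_(j < m) law ALG (g j) (T j) (O j)) * h (O i) =
  \sum_(A : {set N}) law ALG (g i) (T i) A * h A.
Proof.
pose F j A := law ALG (g j) (T j) A * (if j == i then h A else 1).
transitivity (\sum_(O : {ffun 'I_m -> {set N}}) \prod_j F j (O j)).
  apply: eq_bigr => O _; rewrite big_split /=; congr (_ * _).
  by rewrite (bigD1 i) //= eqxx big1 ?mulr1 // => j /negPf ->.
rewrite -(bigA_distr_bigA F) (bigD1 i) //= [X in _ * X]big1 ?mulr1.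
  by apply: eq_bigr => A _; rewrite /F eqxx.
move=> j /negPf ji; rewrite /F ji.
by under eq_bigr do rewrite mulr1; exact: law_sum1.
Qed.

Lemma sum_prod_law (m : nat) (N : finType) (g : 'I_m -> {set N} -> R)
    (T : 'I_m -> {set N}) :
  \sum_(O : {ffun 'I_m -> {set N}}) \prod_(j < m) law ALG (g j) (T j) (O j)
  = 1.
Proof.
rewrite -(bigA_distr_bigA (fun j A => law ALG (g j) (T j) A)) big1 // => j _.
exact: law_sum1.
Qed.

(** Intended use: [v] lists the optimal items and [r] counts the decoy classes. Each class met is
    worth [k]; the extra 1 in [r.+1] pays for the at most [k] points [inr y]. *)
Lemma expected_value_le (m k r : nat) (N Q I : finType) (q : N -> Q)
    (v : I -> N) :
  (0 < m)%N ->
  (forall S : {set N}, #|q @: S| <= r + \sum_(o : I) (v o \in S))%N ->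
  expected_value ALG m k (block_value R k q) <=
  k%:R * (r.+1%:R + (\sum_(a : {ffun N -> 'I_m}) \sum_(o : I)
      output_prob (block_value R k q) (part a (a (v o))) (v o))
      / #|{ffun N -> 'I_m}|%:R).
Proof.
move=> m_gt0 hq; set f := block_value R k q.
have card_gt0 : 0 < #|{ffun N -> 'I_m}|%:R :> R.
  by rewrite ltr0n card_ffun card_ord expn_gt0 m_gt0.
rewrite /expected_value ler_pdivrMr // -mulrA mulrDl mulfVK ?gt_eqF //.
rewrite mulr_natr -sumr_const -big_split /= mulr_sumr.
apply: ler_sum => a _.
set P := fun O : {ffun 'I_m -> {set N}} =>
  \prod_(i < m) law ALG (local_oracle f (part a i)) (part a i) (O i).
have P0 O : 0 <= P O by apply: prodr_ge0 => i _; exact: law_ge0.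
have best_le S : best k f S <= k%:R * (r.+1%:R + \sum_(o : I) (v o \in S)%:R).
  have bnd (S' : {set N}) : S' \subset S -> (#|S'| <= k)%N ->
      f S' <= k%:R * (r.+1%:R + \sum_(o : I) (v o \in S)%:R).
    move=> sS' cS'; rewrite /f block_valueE -natr_sum -natrD -natrM ler_nat.
    rewrite addSn mulnS addnC leq_add // leq_mul //.
    apply: leq_trans (hq S') _; rewrite leq_add2l.
    apply: leq_sum => o _; case: (boolP (v o \in S')) => // vS.
    by rewrite (subsetP sS').
  apply: bigmax_le => [|S' /andP[sS' cS']]; last exact: bnd.
  by apply: bnd; rewrite ?sub0set ?cards0.
have P1 : \sum_O P O = 1 by exact: sum_prod_law.
apply: (@le_trans _ _ (\sum_O P O *
   (k%:R * (r.+1%:R + \sum_(o : I) (v o \in O (a (v o)))%:R)))).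
  apply: ler_sum => O _. rewrite -/(P O).
  (* Outputs are known to lie in their parts only when they have nonzero probability; then [v o] can
     only be output by its own machine [a (v o)]. *)
  have [-> | nz] := eqVneq (P O) 0; first by rewrite !mul0r.
  apply: ler_wpM2l => //; apply: le_trans (best_le _) _.
  rewrite ler_wpM2l // lerD2l; apply: ler_sum => o _.
  rewrite ler_nat; case: bigcupP => // -[i _ vi].
  suff -> : a (v o) = i by rewrite vi.
  move: nz; rewrite /P prodf_seq_neq0 => /allP /(_ i).
  rewrite mem_index_enum => /(_ isT) /law_output[/subsetP/(_ _ vi)].
  by rewrite inE => /eqP.
under [leLHS]eq_bigr do rewrite mulrCA mulrDr.
rewrite -mulr_sumr ler_wpM2l // big_split /= -mulr_suml P1 mul1r lerD2l.
under eq_bigr do rewrite mulr_sumr.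
rewrite exchange_big /=; apply: ler_sum => o _.
by rewrite (sum_output_law _ _ (a (v o)) (fun A => (v o \in A)%:R)).
Qed.

End ExpectedValue.

(** * Optimal items hidden among decoys *)

Section HardInstance.
Variables (k r g m w : nat).

Local Notation item := ('I_k + 'I_r * 'I_g)%type.
Local Notation assignment := {ffun item -> 'I_m.+1}.

(** [inl o] is an optimal item, [inr (j, l)] the decoy number [l] of class [j]. There are [m.+1]
    machines, so that machine indices can be added cyclically. *)
Definition item_class (u : item) : 'I_k + 'I_r :=
  match u with inl o => inl o | inr jl => inr jl.1 end.

Definition isolated (t : assignment) (i : 'I_m.+1) (j : 'I_r) : bool :=
  #|[set l | t (inr (j, l)) == i]| == 1%N.

(* Adding [shift_group j b] for a uniform [b] re-randomizes the machines of
   decoy class [j], and nothing else. *)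
Definition shift_group (j : 'I_r) (b : {ffun 'I_g -> 'I_m.+1}) : assignment :=
  [ffun u => match u with
             | inl _ => 0
             | inr jl => if jl.1 == j then b jl.2 else 0
             end].

(** Choose the place [l0] of the single agreement; each of the other [g.-1] values then avoids one
    machine out of [m.+1]. *)
Lemma count_agree_once (e : 'I_g -> 'I_m.+1) :
  (g * m ^ g.-1 <=
   \sum_(b : {ffun 'I_g -> 'I_m.+1}) (#|[set l | b l == e l]| == 1))%N.
Proof.
(* The product of [F l0 l (b l)] over [l] tests whether [b] agrees with [e] at [l0] and nowhere
   else; as a product it can be summed over [b] factor by factor. *)
pose F (l0 l : 'I_g) (v : 'I_m.+1) : nat := (l == l0) == (v == e l).
have once (b : {ffun 'I_g -> 'I_m.+1}) : (\sum_l0 \prod_l F l0 l (b l) <=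
               (#|[set l | b l == e l]| == 1))%N.
  have FE l0 : (\prod_l F l0 l (b l) =
                ([set l | b l == e l] == [set l0]))%N.
    have [/eqP/setP h | h] := boolP ([set l | b l == e l] == [set l0]).
      rewrite big1 // => l _; move: (h l); rewrite !inE /F => ->.
      by rewrite eqxx.
    have [l hl] : exists l, (l == l0) != (b l == e l).
      apply/existsP; apply: contraNT h => /existsPn h.
      by apply/eqP/setP => l; rewrite !inE; move/negPn/eqP: (h l).
    by rewrite (bigD1 l) //= /F (negPf hl).
  under eq_bigr do rewrite FE.
  have [/cards1P[x ->] | h] := boolP (_ == 1)%N.
    rewrite (bigD1 x) //= eqxx big1 // => y yx.
    by rewrite (inj_eq set1_inj) eq_sym (negPf yx).
  rewrite big1 // => l _; apply/eqP; rewrite eqb0; apply: contraNN h => /eqP ->.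
  by rewrite cards1.
apply: (@leq_trans (\sum_(b : {ffun 'I_g -> 'I_m.+1}) \sum_l0 \prod_l F l0 l (b l)));
  last by apply: leq_sum => b _; exact: once.
rewrite exchange_big /= -[X in (X * _)%N]card_ord -sum_nat_const leq_sum //.
move=> l0 _; rewrite -(bigA_distr_bigA (F l0)) (bigD1 l0) //=.
have -> : (\sum_v F l0 l0 v = 1)%N.
  by rewrite (bigD1 (e l0)) //= /F !eqxx big1 // => v /negPf ->.
rewrite mul1n (eq_bigr (fun=> m)).
  by rewrite prod_nat_const cardC1 card_ord.
move=> l /negPf ll0; rewrite /F ll0.
rewrite -[RHS]/(m.+1.-1) -[in RHS](card_ord m.+1) -(cardC1 (e l)) -sum1_card.
rewrite [RHS]big_mkcond /=; apply: eq_bigr => v _.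
by rewrite inE /=; case: (v == e l).
Qed.

Lemma sum_isolated_shift (t : assignment) (o : 'I_k) (j : 'I_r) :
  (g * m ^ g.-1 <=
   \sum_(b : {ffun 'I_g -> 'I_m.+1})
     isolated (t + shift_group j b)%R ((t + shift_group j b)%R (inl o)) j)%N.
Proof.
apply: leq_trans (count_agree_once (fun l => t (inl o) - t (inr (j, l)))) _.
apply: leq_sum => b _; rewrite /isolated.
rewrite [X in (nat_of_bool (#|pred_of_set X| == _) <= _)%N](_ : _ =
  [set l | (t + shift_group j b)%R (inr (j, l)) ==
           (t + shift_group j b)%R (inl o)]) //.
apply/setP => l; rewrite !inE !ffunE /= eqxx addr0.
by rewrite eq_sym subr_eq eq_sym addrC.
Qed.

Variable R : realType.

(** The first hypothesis says that class [j] is isolated with probability at least 1/4. Invariance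
    of [G] under the shifts replaces independence: averaging over the shifts leaves [G] fixed while
    it re-randomizes class [j]. *)
Lemma isolated_mean (o : 'I_k) (j : 'I_r) (G : assignment -> R) :
  (m.+1 ^ g <= 4 * (g * m ^ g.-1))%N ->
  (forall t, 0 <= G t) ->
  (forall (t : assignment) b, G (t + shift_group j b) = G t) ->
  \sum_t G t <= 4 * \sum_t (isolated t (t (inl o)) j)%:R * G t.
Proof.
move=> hg G0 Gsh.
have M0 : 0 < (m.+1 ^ g)%:R :> R by rewrite ltr0n expn_gt0.
rewrite -(ler_pM2l M0) [leRHS]mulrCA.
have -> : (m.+1 ^ g)%:R * \sum_t (isolated t (t (inl o)) j)%:R * G t =
    \sum_(t : assignment) (\sum_(b : {ffun 'I_g -> 'I_m.+1})
     isolated (t + shift_group j b)%R ((t + shift_group j b)%R (inl o)) j)%N%:R * G t.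
  have <- : #|{ffun 'I_g -> 'I_m.+1}| = (m.+1 ^ g)%N.
    by rewrite card_ffun !card_ord.
  rewrite mulr_natl -sumr_const.
  under [RHS]eq_bigr do rewrite natr_sum mulr_suml.
  rewrite [RHS]exchange_big /=; apply: eq_bigr => b _.
  rewrite (reindex (fun t : assignment => t + shift_group j b)) /=.
    by apply: eq_bigr => t _; rewrite Gsh.
  exists (fun t : assignment => t - shift_group j b) => t _;
    [exact: addrK|exact: subrK].
rewrite !mulr_sumr; apply: ler_sum => t _; rewrite mulrA ler_wpM2r //.
rewrite -natrM ler_nat; apply: leq_trans hg _.
by rewrite leq_mul2l sum_isolated_shift.
Qed.

Lemma sum_inv_isolated (o : 'I_k) :
  (m.+1 ^ g <= 4 * (g * m ^ g.-1))%N ->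
  r%:R * (\sum_(t : assignment)
    (1 + \sum_j (isolated t (t (inl o)) j)%:R)^-1) <=
  4 * #|{: assignment}|%:R :> R.
Proof.
move=> hg; set X := fun t j => (isolated t (t (inl o)) j)%:R : R.
have X0 t j : 0 <= X t j by exact: ler0n.
(* Class [j] is left out, which makes [G j] invariant under its shifts; where [X t j] is 1, the
   denominator of [G j t] is the full count. *)
pose G j t := (1 + \sum_(j' | j' != j) X t j')^-1.
have le0 t j : 0 <= \sum_(j' | j' != j) X t j' by exact: sumr_ge0.
have G0 j t : 0 <= G j t by rewrite invr_ge0 addr_ge0.
have Gsh j (t : assignment) b : G j (t + shift_group j b) = G j t.
  congr (1 + _)^-1; apply: eq_bigr => j' /negPf jj'.
  rewrite /X /isolated; congr (nat_of_bool (_ == _))%:R.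
  by apply: eq_card => l; rewrite !inE !ffunE /= jj' !addr0.
rewrite -[r in r%:R]card_ord mulr_natl -sumr_const.
apply: (@le_trans _ _ (\sum_j 4 * \sum_t X t j * G j t)).
  apply: ler_sum => j _; apply: le_trans (isolated_mean o hg (G0 j) (Gsh j)).
  apply: ler_sum => t _; rewrite /G (bigD1 j) //= addrCA.
  have G1 : 0 < 1 + \sum_(j' | j' != j) X t j' by rewrite ltr_pwDl.
  by rewrite lef_pV2 ?posrE ?lerDr // ltr_wpDl.
rewrite -mulr_sumr ler_wpM2l // exchange_big /= -sumr_const.
apply: ler_sum => t _.
have [D0 | D0] := eqVneq (\sum_j X t j) 0.
  rewrite big1 // => j _; suff -> : X t j = 0 by rewrite mul0r.
  by apply/eqP; move/eqP: D0; rewrite psumr_eq0 // => /allP/(_ j (mem_index_enum _)).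
rewrite -(divff D0) mulr_suml; apply: ler_sum => j _.
have [-> | Xj] := eqVneq (X t j) 0; first by rewrite !mul0r.
rewrite /G [in leRHS](bigD1 j) //= ler_wpM2l //.
have -> // : X t j = 1.
by move: Xj; rewrite /X; case: isolated; rewrite ?eqxx.
Qed.

Variables (k' : nat) (ALG : algorithm R k').

(** Names and roles are separated: the item named [x] plays the role [s x], and [t] assigns machines
    to roles. This is the probability that the item in role [u] is output by its machine. *)
Definition placed_prob (s : {perm item}) (t : assignment) (u : item) : R :=
  output_prob ALG (block_value R w (item_class \o s))
    [set x | t (s x) == t u] (s^-1 u)%g.

(** Following [s] by the transposition of the two roles permutes the namings and changes neither the
    item set nor the oracle of the machine, so the two sums have equal terms after reindexing. *)
Lemma placed_prob_swap (t : assignment) (o : 'I_k) (u : item) :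
  t u = t (inl o) ->
  (forall u', t u' = t u -> item_class u' = item_class u -> u' = u) ->
  \sum_s placed_prob s t (inl o) = \sum_s placed_prob s t u.
Proof.
move=> tu alone_u.
rewrite [RHS](reindex_inj (mulIg (tperm (inl o) u))) /=.
apply: eq_bigr => s _; rewrite /placed_prob.
have -> : ((s * tperm (inl o) u)^-1 u)%g = (s^-1 (inl o))%g.
  by rewrite invMg permM tpermV tpermR.
have -> : [set x | t ((s * tperm (inl o) u)%g x) == t u] =
          [set x | t (s x) == t (inl o)].
  apply/setP => x; rewrite !inE permM tu.
  by case: tpermP => [-> | -> |]; rewrite ?tu ?eqxx.
rewrite /output_prob.
set T := [set x | _].
suff -> : local_oracle (block_value R w (item_class \o (s * tperm (inl o) u)%g)) T
   = local_oracle (block_value R w (item_class \o s)) T by [].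
(* A transposition of roles after [s] is the conjugate transposition of names before [s]. *)
have -> : item_class \o (s * tperm (inl o) u)%g =
          (item_class \o s) \o tperm (s^-1 (inl o))%g (s^-1 u)%g.
  apply/funext => x /=; congr item_class; rewrite permM.
  case: (tpermP (s^-1 (inl o))%g) => [->|->|xo xu].
  - by rewrite !permKV tpermL.
  - by rewrite !permKV tpermR.
  by rewrite tpermD //; apply/eqP => E; [apply: xo|apply: xu]; rewrite E permK.
apply: local_oracle_swap; split; rewrite ?inE ?permKV ?tu //.
  move=> y _ /=; rewrite permKV /=; case E : (s y) => [o'|//] [oo'].
  by apply: (canRL (permK s)); rewrite E oo'.
move=> y; rewrite inE /= permKV => /eqP ty cy.
by apply: (canRL (permK s)); apply: alone_u; rewrite ?tu.
Qed.

(** The optimal item and the isolated decoys on its machine, gathered in [A], share the same total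
    [W]. For each fixed [s] their output probabilities add up to at most [k']. *)
Lemma sum_placed_prob (t : assignment) (o : 'I_k) :
  (\sum_s placed_prob s t (inl o)) *
    (1 + \sum_j (isolated t (t (inl o)) j)%:R) <=
  k'%:R * #|{: {perm item}}|%:R.
Proof.
set W := \sum_(s : {perm item}) _.
pose A : {set item} := [set u | match u with
   | inl o' => o' == o
   | inr jl => isolated t (t (inl o)) jl.1 && (t (inr jl) == t (inl o)) end].
have tA u : u \in A -> t u = t (inl o).
  by rewrite inE; case: u => [o' /eqP->|jl /andP[_ /eqP]].
have WA u : u \in A -> W = \sum_s placed_prob s t u.
  move=> uA; rewrite /W; apply: placed_prob_swap; first exact: tA.
  move=> u'; rewrite (tA _ uA); move: uA; rewrite inE.
  case: u => [o1 _ | [j l] /andP[/= iso /eqP tl]]; case: u' => [o'|[j' l']] //=.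
    by move=> _ [->].
  move=> tl' [jj']; subst j'; case/cards1P: iso => x hx.
  move/setP: (hx) => /(_ l); rewrite !inE tl eqxx => /esym/eqP ->.
  by move/setP: (hx) => /(_ l'); rewrite !inE tl' eqxx => /esym/eqP ->.
have -> : W * (1 + \sum_j (isolated t (t (inl o)) j)%:R) = \sum_(u in A) W.
  rewrite sumr_const -mulr_natr; congr (_ * _).
  rewrite -sum1_card natr_sum [RHS]big_mkcond big_sumType /=; congr (_ + _).
    rewrite (bigD1 o) //= inE eqxx big1 ?addr0 // => o' /negPf.
    by rewrite inE => ->.
  transitivity (\sum_j \sum_l (if inr (j, l) \in A then 1 else 0 : R)); last first.
    by rewrite pair_bigA; apply: eq_bigr => -[].
  apply: eq_bigr => j _; under [RHS]eq_bigr do rewrite inE /=.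
  have [iso | _] := boolP (isolated _ _ _); last by rewrite big1.
  rewrite -big_mkcond /= sumr_const.
  by move/eqP: iso; rewrite cardsE => ->.
rewrite (eq_bigr _ WA) exchange_big /= mulr_natr -sumr_const.
apply: ler_sum => s _.
apply: le_trans (sum_output_prob ALG (block_value R w (item_class \o s))
  [set x | t (s x) == t (inl o)] ((s^-1)%g @: A)).
rewrite big_imset /=; last by move=> ? ? _ _; exact: perm_inj.
rewrite (eq_bigr (fun u => output_prob ALG (block_value R w (item_class \o s))
  [set x | t (s x) == t (inl o)] (s^-1 u)%g)) // => u uA.
by rewrite /placed_prob (tA _ uA).
Qed.

End HardInstance.

(** * Two elementary estimates *)

Lemma ex_le_mean (R : realType) (T : finType) (x0 : T) (F : T -> R) (B : R) :
  \sum_x F x <= B * #|T|%:R -> exists x, F x <= B.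
Proof.
move=> leB; apply/existsP; apply: contraTT leB => /existsPn ltB.
rewrite -ltNge mulr_natr -sumr_const; apply: ltr_sum => [|x _].
  by apply/hasP; exists x0; rewrite ?mem_index_enum.
by rewrite ltNge ltB.
Qed.

(** Bernoulli's inequality with denominators cleared: [(1 - 1/(m+1))^n] is at least [1 - n/(m+1)],
    hence at least 1/2. *)
Lemma pred_expn_ge (m n : nat) :
  (n.*2 <= m.+1)%N -> (m.+1 ^ n <= 2 * m ^ n)%N.
Proof.
move=> hn.
have bernoulli : ((m.+1 - n) * m.+1 ^ n <= m.+1 * m ^ n)%N.
  elim: n {hn} => [|n IH]; first by rewrite subn0.
  rewrite !expnS mulnA [leqRHS]mulnCA.
  apply: (@leq_trans (m * ((m.+1 - n) * m.+1 ^ n))).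
    by rewrite mulnA leq_mul2r; apply/orP; right; nia.
  by rewrite leq_mul2l IH orbT.
rewrite -(leq_pmul2l (ltn0Sn m)) [leqRHS]mulnCA.
apply: leq_trans (leq_mul (leqnn 2) bernoulli).
by rewrite mulnA leq_mul2r; apply/orP; right; lia.
Qed.

(** * Averaging over the names of the items *)

Section Averaging.
Variables (R : realType) (k k' r g m : nat) (ALG : algorithm R k').

Local Notation item := ('I_k + 'I_r * 'I_g)%type.
Local Notation planted s :=
  (block_value R k (@item_class k r g \o (s : {perm item}))).

(** The [k] optimal items lie in distinct classes, each worth [k]. *)
Lemma best_planted (s : {perm item}) :
  (k * k)%:R <= best k (planted s) setT.
Proof.
pose S := [set (s^-1)%g (inl o) | o in [set: 'I_k]].
have cS : #|S| = k.
  rewrite card_imset ?cardsT ?card_ord //.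
  by move=> o o' /perm_inj[].
apply: (@le_trans _ _ (planted s S)); last first.
  by apply: (@le_bigmax_cond _ _ _ _ S); rewrite subsetT cS leqnn.
rewrite block_valueE ler_nat (_ : _ @: S = [set inl o | o in [set: 'I_k]]).
  rewrite (card_imset _ (@inl_inj _ _)) cardsT card_ord; exact: leq_addr.
rewrite -imset_comp; by apply: eq_imset => o /=; rewrite permKV.
Qed.

Lemma expected_planted_le (s : {perm item}) :
  expected_value ALG m.+1 k (planted s) <=
  k%:R * (r.+1%:R +
    (\sum_(t : {ffun item -> 'I_m.+1}) \sum_(o : 'I_k)
       placed_prob k ALG s t (inl o)) / #|{ffun item -> 'I_m.+1}|%:R).
Proof.
set q := @item_class k r g \o s.
pose v (o : 'I_k) : item := (s^-1)%g (inl o).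
have hq (S : {set item}) : (#|q @: S| <= r + \sum_(o : 'I_k) (v o \in S))%N.
  have -> : (\sum_(o : 'I_k) (v o \in S) = #|[set o | v o \in S]|)%N.
    by rewrite -sum1_card [RHS]big_mkcond; apply: eq_bigr => o _;
      rewrite inE; case: ifP.
  rewrite -[X in (X + _)%N]card_ord -cardsT.
  rewrite -(card_imset _ (@inr_inj 'I_k 'I_r)).
  rewrite -(card_imset [set o | v o \in S] (@inl_inj 'I_k 'I_r)).
  apply: leq_trans (leq_card_setU _ _); apply: subset_leq_card.
  apply/subsetP => _ /imsetP[x xS ->]; rewrite inE /q /=.
  case E : (s x) => [o | [j l]] /=; apply/orP; [right | left].
    by apply: imset_f; rewrite inE /v -E permK.
  by apply: imset_f; rewrite inE.
apply: le_trans (expected_value_le ALG k (ltn0Sn m) hq) _.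
rewrite ler_wpM2l // lerD2l ler_wpM2r ?invr_ge0 //.
(* A uniform assignment of names is a uniform assignment of roles composed with [s]. *)
rewrite (reindex (fun t : {ffun item -> 'I_m.+1} => [ffun x => t (s x)])) /=.
  apply: ler_sum => t _; apply: ler_sum => o _; rewrite /placed_prob.
  rewrite (_ : part _ _ = [set x | t (s x) == t (inl o)]) //.
  by apply/setP => x; rewrite !inE !ffunE permKV.
exists (fun t : {ffun item -> 'I_m.+1} => [ffun x => t (s^-1 x)%g]) => t _;
  by apply/ffunP => x; rewrite !ffunE ?permK ?permKV.
Qed.

(** The bound holds on average over the namings, hence for some naming, which may depend on
    [ALG]. *)
Lemma exists_planted_le :
  (0 < r)%N -> (m.+1 ^ g <= 4 * (g * m ^ g.-1))%N ->
  exists s : {perm item},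
    expected_value ALG m.+1 k (planted s) <=
    k%:R * (r.+1%:R + 4 * k%:R * k'%:R / r%:R).
Proof.
move=> r_gt0 hg; apply: (ex_le_mean 1%g).
have r0 : 0 < r%:R :> R by rewrite ltr0n.
set Mn : R := #|{ffun item -> 'I_m.+1}|%:R.
have Mn0 : 0 < Mn by rewrite ltr0n card_ffun card_ord expn_gt0.
apply: le_trans (ler_sum _ (fun s _ => expected_planted_le s)) _.
rewrite -mulr_sumr -[leRHS]mulrA ler_wpM2l // big_split /= sumr_const.
rewrite mulrDl mulr_natr.
rewrite lerD2l -mulr_suml ler_pdivrMr // exchange_big /=.
under eq_bigr do rewrite exchange_big /=.
rewrite exchange_big /=.
have pt (o : 'I_k) (t : {ffun item -> 'I_m.+1}) :
    \sum_(s : {perm item}) placed_prob k ALG s t (inl o) <=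
    k'%:R * #|{: {perm item}}|%:R *
      (1 + \sum_j (isolated t (t (inl o)) j)%:R)^-1.
  rewrite ler_pdivlMr; first exact: sum_placed_prob.
  by rewrite ltr_pwDl // sumr_ge0.
apply: (@le_trans _ _ (\sum_(o : 'I_k)
    k'%:R * #|{: {perm item}}|%:R * (4 * Mn / r%:R))).
  apply: ler_sum => o _; apply: le_trans (ler_sum _ (fun t _ => pt o t)) _.
  rewrite -mulr_sumr ler_wpM2l ?mulr_ge0 // ler_pdivlMr // mulrC.
  exact: sum_inv_isolated.
rewrite sumr_const card_ord -mulr_natl le_eqVlt; apply/orP; left; apply/eqP.
by ring.
Qed.

End Averaging.

(** * Choice of the parameters and conclusion *)

Theorem theorem9 (R : realType) (c1 c2 : R) (hc1 : 0 < c1) (hc2 : 0 < c2) :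
  exists2 C : R, 0 < C &
  forall k k' m : nat,
    (1 <= k')%N -> (k' <= k)%N ->
    c1 * (k%:R / k'%:R) <= m%:R -> m%:R <= c2 * (k%:R / k'%:R) ->
  forall ALG : algorithm R k',
    (forall alpha : R, randomized_coreset ALG m k alpha ->
       alpha <= C * Num.sqrt (k'%:R / k%:R))
    /\
    (exists (N U : finType) (c : N -> {set U}),
       let f := @coverage R N U c in
       [/\ injective c,
           0 < best k f setT
         & expected_value ALG m k f
             <= C * Num.sqrt (k'%:R / k%:R) * best k f setT]).
Proof.
(* With [s = sqrt (k k')], 7 is 3 + 4: [r + 1 <= 2 s + 1 <= 3 s] for the decoys, and
   [4 k k' / r <= 4 s] for the optimal items. *)
exists 7 => // k k' m k'_gt0 le_k'k m_ge _ ALG.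
have k_gt0 : (0 < k)%N by exact: leq_trans le_k'k.
have k'0 : 0 < k'%:R :> R by rewrite ltr0n.
have k0 : 0 < k%:R :> R by rewrite ltr0n.
case: m m_ge => [|m _].
  by rewrite leNgt mulr_gt0 // divr_gt0.
suff [N [U [c [c_inj best_gt0 le_best]]]] :
    exists (N U : finType) (c : N -> {set U}),
      let f := @coverage R N U c in
      [/\ injective c, 0 < best k f setT
        & expected_value ALG m.+1 k f
             <= 7 * Num.sqrt (k'%:R / k%:R) * best k f setT].
  split; last by exists N, U, c.
  move=> alpha /(_ N (coverage R c)) core.
  rewrite -(ler_pM2r best_gt0); apply: le_trans le_best; apply: core.
  - exact: coverage_nonneg.
  - exact: coverage_monotone.
  - exact: coverage_submodular.
set s : R := Num.sqrt (k%:R * k'%:R).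
have ss : s ^+ 2 = k%:R * k'%:R by rewrite sqr_sqrtr // mulr_ge0.
have s1 : 1 <= s.
  have kk1 : 1 <= k%:R * k'%:R :> R by rewrite -natrM ler1n muln_gt0 k_gt0.
  by rewrite -[leLHS]sqrtr1 ler_sqrt // mulr_ge0.
have s0 : 0 < s by exact: lt_le_trans s1.
set r := (Num.truncn s).+1.
have lt_sr : s < r%:R by exact: truncnS_gt.
have le_r : r%:R <= 2 * s.
  have le_trunc : (Num.truncn s)%:R <= s by rewrite truncn_le ltW.
  by rewrite /r -natr1; lra.
(* This size satisfies both [m.+1 <= 2 * g] and [2 * g.-1 <= m.+1]; each costs a factor 2 in the
   isolation probability, whence 1/4. *)
set g := (m.+1./2).+1.
have hg : (m.+1 ^ g <= 4 * (g * m ^ g.-1))%N.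
  rewrite /g /= expnS -(mulnA 2 2) (mulnCA 2) mulnA.
  by apply: leq_mul; [lia | apply: pred_expn_ge; lia].
have [p le_p] := exists_planted_le k ALG (ltn0Sn _ : (0 < r)%N) hg.
have best_ge := @best_planted R k r g p.
exists ('I_k + 'I_r * 'I_g)%type,
  (('I_k + 'I_r) * 'I_k + ('I_k + 'I_r * 'I_g))%type,
  (block_cover k (@item_class k r g \o p)).
split; first exact: block_cover_inj.
  by apply: lt_le_trans best_ge; rewrite ltr0n muln_gt0 k_gt0.
apply: le_trans le_p _.
have -> : Num.sqrt (k'%:R / k%:R) = s / k%:R.
  have -> : k'%:R / k%:R = (s / k%:R) ^+ 2.
    by rewrite expr_div_n ss expr2 invfM mulrACA divff ?gt_eqF // mul1r.
  by rewrite sqrtr_sqr ger0_norm // divr_ge0 // ltW.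
apply: (@le_trans _ _ (7 * (s / k%:R) * (k * k)%:R)); last first.
  by apply: ler_wpM2l best_ge; rewrite mulr_ge0 // divr_ge0 // ltW.
have -> : 7 * (s / k%:R) * (k * k)%:R = k%:R * (7 * s).
  by rewrite natrM; field; rewrite gt_eqF.
rewrite ler_wpM2l //.
have le4 : 4 * k%:R * k'%:R / r%:R <= 4 * s.
  rewrite ler_pdivrMr; last exact: lt_trans lt_sr.
  rewrite -mulrA -ss expr2 -mulrA ler_pM2l // ler_pM2l //; exact: ltW.
by rewrite -natr1; lra.
Qed.
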